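(* Let $\mathcal{D}$ be a triangulated category with arbitrary coproducts, and let $S$ be an object of $\mathcal{D}$ such that the graded endomorphism ring $R=\pi_*S$ is commutative and concentrated in degree zero. Then the generating hypothesis is true in $\mathcal{D}$ (with respect to $S$) if and only if $R$ is von Neumann regular.
   Context: For an object $S$ of a triangulated category $\mathcal{D}$ with suspension $\Sigma$, write $\pi_i X=[S,X]_i=\operatorname{Hom}_{\mathcal{D}}(\Sigma^i S,X)$ for $i\in\mathbb{Z}$ and $\pi_*X=\bigoplus_i\pi_iX$; $\pi_*S$ is a graded ring under composition. The thick subcategory $\mathbf{thick}\langle S\rangle$ is the smallest class of objects of $\mathcal{D}$ containing $S$ and closed under (de)suspension, retracts, and cofiber sequences (if two of three objects in an exact triangle belong to it, so does the third). The generating hypothesis in $\mathcal{D}$ (with respect to $S$) is the statement: if $f:X\to Y$ is a morphism between objects of $\mathbf{thick}\langle S\rangle$ and $\pi_*f=0$, then $f=0$. A ring $R$ is von Neumann regular if for every $x\in R$ there is $y\in R$ with $xyx=x$. *)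

(* Defs.v *)
From HB Require Import structures.
From mathcomp Require Import all_boot all_order all_algebra.
From mathcomp Require Import zify boolp classical_sets functions cardinality fsbigop.

Set Implicit Arguments.
Unset Strict Implicit.
Unset Printing Implicit Defensive.

Import GRing.Theory.
Local Open Scope classical_set_scope.
Local Open Scope ring_scope.

Declare Scope cat_scope.
Delimit Scope cat_scope with cat.
Local Open Scope cat_scope.

Record preadditive := Preadditive {
  obj :> Type;
  hom : obj -> obj -> zmodType;
  idm : forall X, hom X X;
  cmp : forall X Y Z, hom Y Z -> hom X Y -> hom X Z;
  cmpA : forall W X Y Z (h : hom Y Z) (g : hom X Y) (f : hom W X),
    cmp h (cmp g f) = cmp (cmp h g) f;
  cmp1l : forall X Y (f : hom X Y), cmp (idm Y) f = f;
  cmp1r : forall X Y (f : hom X Y), cmp f (idm X) = f;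
  cmpDl : forall X Y Z (g g' : hom Y Z) (f : hom X Y),
    cmp (g + g') f = cmp g f + cmp g' f;
  cmpDr : forall X Y Z (g : hom Y Z) (f f' : hom X Y),
    cmp g (f + f') = cmp g f + cmp g f' }.

Arguments hom {_} _ _.
Arguments idm {_} _.
Arguments cmp {_ _ _ _} _ _.

Notation "g ∘ f" := (cmp g f) (at level 40, left associativity) : cat_scope.

Section Preadditive.
Variable C : preadditive.
Implicit Types X Y Z : C.

Lemma cmp0l X Y Z (f : hom X Y) : (0 : hom Y Z) ∘ f = 0.
Proof. by apply: (addrI (0 ∘ f)); rewrite -cmpDl !addr0. Qed.

Lemma cmp0r X Y Z (g : hom Y Z) : g ∘ (0 : hom X Y) = 0.
Proof. by apply: (addrI (g ∘ 0)); rewrite -cmpDr !addr0. Qed.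

Definition inverses X Y (f : hom X Y) (g : hom Y X) : Prop :=
  g ∘ f = idm X /\ f ∘ g = idm Y.

Definition is_iso X Y (f : hom X Y) : Prop := exists g, inverses f g.

Definition is_zero X : Prop := idm X = 0.

Definition is_biproduct X Y P (i1 : hom X P) (i2 : hom Y P)
    (p1 : hom P X) (p2 : hom P Y) : Prop :=
  [/\ p1 ∘ i1 = idm X, p2 ∘ i2 = idm Y, p1 ∘ i2 = 0, p2 ∘ i1 = 0
    & i1 ∘ p1 + i2 ∘ p2 = idm P].

Definition is_retract X Y : Prop :=
  exists (i : hom X Y) (r : hom Y X), r ∘ i = idm X.

Definition is_coproduct (I : Type) (X : I -> C) (P : C)
    (inj : forall i, hom (X i) P) : Prop :=
  forall (Y : C) (f : forall i, hom (X i) Y),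
    exists! g : hom P Y, forall i, g ∘ inj i = f i.

End Preadditive.

(** [I] ranges over one fixed universe, the analogue of the sets indexing
    coproducts.  No constraint ties that universe to the one of [obj C], so
    large categories are allowed. *)
Definition has_coproducts (C : preadditive) : Prop :=
  forall (I : Type) (X : I -> C),
    exists (P : C) (inj : forall i, hom (X i) P), is_coproduct inj.

Definition is_additive (C : preadditive) : Prop :=
  (exists Z : C, is_zero Z) /\
  (forall X Y : C, exists (P : C) (i1 : hom X P) (i2 : hom Y P)
     (p1 : hom P X) (p2 : hom P Y), is_biproduct i1 i2 p1 p2).

Record functor (C D : preadditive) := Functor {
  fobj :> C -> D;
  fmap : forall X Y, hom X Y -> hom (fobj X) (fobj Y);
  fmap1 : forall X, fmap (idm X) = idm (fobj X);
  fmapM : forall X Y Z (g : hom Y Z) (f : hom X Y),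
    fmap (g ∘ f) = fmap g ∘ fmap f }.

Arguments fmap {_ _} _ {_ _} _.

(** An additive self-equivalence [aeF], with a chosen quasi-inverse [aeG].
    [aeF] is not required to be bijective on objects. *)
Record autoequivalence (C : preadditive) := Autoequivalence {
  aeF : functor C C;
  aeG : functor C C;
  aeFD : forall (X Y : C) (f g : hom X Y),
    fmap aeF (f + g) = fmap aeF f + fmap aeF g;
  ae_unit : forall X : C, hom X (aeG (aeF X));
  ae_unitV : forall X : C, hom (aeG (aeF X)) X;
  ae_unitK : forall X, inverses (ae_unit X) (ae_unitV X);
  ae_unit_nat : forall (X Y : C) (f : hom X Y),
    ae_unit Y ∘ f = fmap aeG (fmap aeF f) ∘ ae_unit X;
  ae_counit : forall X : C, hom (aeF (aeG X)) X;
  ae_counitV : forall X : C, hom X (aeF (aeG X));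
  ae_counitK : forall X, inverses (ae_counit X) (ae_counitV X);
  ae_counit_nat : forall (X Y : C) (f : hom X Y),
    f ∘ ae_counit X = ae_counit Y ∘ fmap aeF (fmap aeG f) }.

(** [dist f g h] says that [X -f-> Y -g-> Z -h-> ΣX] is an exact triangle. *)
Record triangulated := Triangulated {
  tr_cat :> preadditive;
  tr_additive : is_additive tr_cat;
  tr_susp : autoequivalence tr_cat;
  dist : forall X Y Z : tr_cat,
    hom X Y -> hom Y Z -> hom Z (aeF tr_susp X) -> Prop;
  (* TR1 *)
  dist_iso : forall (X Y Z X' Y' Z' : tr_cat)
      (f : hom X Y) (g : hom Y Z) (h : hom Z (aeF tr_susp X))
      (f' : hom X' Y') (g' : hom Y' Z') (h' : hom Z' (aeF tr_susp X'))
      (a : hom X X') (b : hom Y Y') (c : hom Z Z'),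
    is_iso a -> is_iso b -> is_iso c ->
    b ∘ f = f' ∘ a -> c ∘ g = g' ∘ b -> fmap (aeF tr_susp) a ∘ h = h' ∘ c ->
    dist f g h -> dist f' g' h';
  dist_id : forall X Z : tr_cat, is_zero Z ->
    dist (idm X) (0 : hom X Z) (0 : hom Z (aeF tr_susp X));
  dist_cone : forall (X Y : tr_cat) (f : hom X Y),
    exists (Z : tr_cat) (g : hom Y Z) (h : hom Z (aeF tr_susp X)), dist f g h;
  (* TR2 *)
  dist_rot : forall (X Y Z : tr_cat)
      (f : hom X Y) (g : hom Y Z) (h : hom Z (aeF tr_susp X)),
    dist f g h <-> dist g h (- fmap (aeF tr_susp) f);
  (* TR3 *)
  dist_map : forall (X Y Z X' Y' Z' : tr_cat)
      (f : hom X Y) (g : hom Y Z) (h : hom Z (aeF tr_susp X))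
      (f' : hom X' Y') (g' : hom Y' Z') (h' : hom Z' (aeF tr_susp X'))
      (a : hom X X') (b : hom Y Y'),
    dist f g h -> dist f' g' h' -> b ∘ f = f' ∘ a ->
    exists c : hom Z Z', c ∘ g = g' ∘ b /\ fmap (aeF tr_susp) a ∘ h = h' ∘ c;
  (* TR4, the octahedral axiom *)
  dist_oct : forall (X Y Z U V W : tr_cat)
      (f : hom X Y) (p1 : hom Y U) (d1 : hom U (aeF tr_susp X))
      (g : hom Y Z) (p2 : hom Z V) (d2 : hom V (aeF tr_susp Y))
      (p3 : hom Z W) (d3 : hom W (aeF tr_susp X)),
    dist f p1 d1 -> dist g p2 d2 -> dist (g ∘ f) p3 d3 ->
    exists (u : hom U W) (v : hom W V),
      [/\ dist u v (fmap (aeF tr_susp) p1 ∘ d2),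
          u ∘ p1 = p3 ∘ g, d3 ∘ u = d1,
          v ∘ p3 = p2 & d2 ∘ v = fmap (aeF tr_susp) f ∘ d3] }.

Definition Sigma (D : triangulated) : functor D D := aeF (tr_susp D).
Definition Omega (D : triangulated) : functor D D := aeG (tr_susp D).
Arguments Sigma {D}.
Arguments Omega {D}.

(** [Σ^i X] for [i : int]; [Negz n] is [-(n+1)]. *)
Definition spow (D : triangulated) (i : int) (X : D) : D :=
  match i with
  | Posz n => iter n Sigma X
  | Negz n => iter n.+1 Omega X
  end.

Record is_thick (D : triangulated) (P : D -> Prop) : Prop := IsThick {
  thick_susp : forall X, P X -> P (Sigma X);
  thick_desusp : forall X, P X -> P (Omega X);
  thick_retract : forall X Y, is_retract X Y -> P Y -> P X;
  thick_cofiber : forall (X Y Z : D)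
      (f : hom X Y) (g : hom Y Z) (h : hom Z (Sigma X)),
    dist f g h ->
    [/\ P X -> P Y -> P Z, P X -> P Z -> P Y & P Y -> P Z -> P X] }.

Definition in_thick (D : triangulated) (S X : D) : Prop :=
  forall P : D -> Prop, is_thick P -> P S -> P X.

Record dsum (I : choiceType) (G : I -> zmodType) := Dsum {
  dfun :> forall i, G i;
  dfunP : finite_set [set i | dfun i != 0] }.

Section DirectSum.
Variables (I : choiceType) (G : I -> zmodType).
Implicit Types x y z : dsum G.

Lemma dsumP x y : (forall i, x i = y i) -> x = y.
Proof.
case: x y => [f fP] [g gP] /= fg; have e : f = g by exact: functional_extensionality_dep.
by case: _ / e gP => gP; rewrite (Prop_irrelevance fP gP).
Qed.

Lemma dsum_supp x : exists2 s : seq I, uniq s & forall i, i \notin s -> x i = 0.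
Proof.
have /finite_seqP[s es] := dfunP x; exists (undup s); first exact: undup_uniq.
move=> i; rewrite mem_undup => nis; apply/eqP; apply: contraNT nis => xi.
by have : [set i | x i != 0] i by []; rewrite es.
Qed.

Lemma dsum_finite (f : forall i, G i) (s : seq I) :
  (forall i, i \notin s -> f i = 0) -> finite_set [set i | f i != 0].
Proof.
move=> fs; apply: (@sub_finite_set _ _ [set` s]); last exact: finite_seq.
by move=> i /=; apply: contraR => /fs ->.
Qed.

Lemma dsum0_subproof : finite_set [set i | (0 : G i) != 0].
Proof. exact: (@dsum_finite (fun i => 0) [::]). Qed.
Definition dsum0 : dsum G := Dsum dsum0_subproof.

Lemma dsumN_subproof x : finite_set [set i | - x i != 0].
Proof.
have [s _ sP] := dsum_supp x.
by apply: (@dsum_finite _ s) => i /sP ->; rewrite oppr0.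
Qed.
Definition dsumN x : dsum G := Dsum (dsumN_subproof x).

Lemma dsumD_subproof x y : finite_set [set i | x i + y i != 0].
Proof.
have [s _ sP] := dsum_supp x; have [t _ tP] := dsum_supp y.
apply: (@dsum_finite _ (s ++ t)) => i.
by rewrite mem_cat negb_or => /andP[/sP-> /tP->]; rewrite addr0.
Qed.
Definition dsumD x y : dsum G := Dsum (dsumD_subproof x y).

Lemma dsumDA : associative dsumD.
Proof. by move=> x y z; apply: dsumP => i /=; rewrite addrA. Qed.
Lemma dsumDC : commutative dsumD.
Proof. by move=> x y; apply: dsumP => i /=; rewrite addrC. Qed.
Lemma dsum0D : left_id dsum0 dsumD.
Proof. by move=> x; apply: dsumP => i /=; rewrite add0r. Qed.
Lemma dsumND : left_inverse dsum0 dsumN dsumD.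
Proof. by move=> x; apply: dsumP => i /=; rewrite addNr. Qed.

HB.instance Definition _ := gen_eqMixin (dsum G).
HB.instance Definition _ := gen_choiceMixin (dsum G).
HB.instance Definition _ :=
  GRing.isZmodule.Build (dsum G) dsumDA dsumDC dsum0D dsumND.

End DirectSum.

Section Homotopy.
Variable D : triangulated.
Implicit Types S X Y : D.

(** [π_i X], computed with respect to [S]. *)
Definition pi S (i : int) X : zmodType := hom (spow i S) X.

(** [π_* X = ⊕_i π_i X]. *)
Definition pi_total S X : zmodType := dsum (fun i => pi S i X).

Lemma pi_map_subproof S X Y (f : hom X Y) (x : pi_total S X) :
  finite_set [set i | f ∘ x i != 0].
Proof.
have [s _ sP] := dsum_supp x.
by apply: (@dsum_finite _ _ _ s) => i /sP ->; rewrite cmp0r.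
Qed.

Definition pi_map S X Y (f : hom X Y) (x : pi_total S X) : pi_total S Y :=
  Dsum (pi_map_subproof f x).

Definition generating_hypothesis S : Prop :=
  forall (X Y : D) (f : hom X Y), in_thick S X -> in_thick S Y ->
    (forall x : pi_total S X, pi_map f x = 0) -> f = 0.

End Homotopy.

Definition zsucc (i : int) : int :=
  match i with
  | Posz n => Posz n.+1
  | Negz 0 => Posz 0
  | Negz n.+1 => Negz n
  end.

Lemma zsuccE i : zsucc i = i + 1.
Proof. by case: i => [n|[|n]] //=; rewrite ?NegzE -?PoszD; lia. Qed.

Lemma iter_zsucc n i : iter n zsucc i = i + n%:Z.
Proof. by elim: n => [|n IHn] /=; rewrite ?addr0 // IHn zsuccE; lia. Qed.

Section Translation.
Variables (D : triangulated) (S : D).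
Local Notation P i := (spow i S).

(** The canonical isomorphism [Σ (Σ^i S) ≅ Σ^(i+1) S]. *)
Definition spow_succ (i : int) : hom (Sigma (P i)) (P (zsucc i)) :=
  match i with
  | Posz n => idm _
  | Negz 0 => ae_counit (tr_susp D) S
  | Negz n.+1 => ae_counit (tr_susp D) (iter n.+1 Omega S)
  end.

Definition spow_succV (i : int) : hom (P (zsucc i)) (Sigma (P i)) :=
  match i with
  | Posz n => idm _
  | Negz 0 => ae_counitV (tr_susp D) S
  | Negz n.+1 => ae_counitV (tr_susp D) (iter n.+1 Omega S)
  end.

Lemma spow_succK i : inverses (spow_succ i) (spow_succV i).
Proof.
by case: i => [n|[|n]] /=; [split; exact: cmp1l | exact: ae_counitK ..].
Qed.

Definition shift k i (f : hom (P k) (P i)) : hom (P (zsucc k)) (P (zsucc i)) :=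
  spow_succ i ∘ fmap Sigma f ∘ spow_succV k.

(** A two-sided inverse of [fmap Sigma]; see [SigmaK] and [Sigma_invK]. *)
Definition Sigma_inv (X Y : D) (g : hom (Sigma X) (Sigma Y)) : hom X Y :=
  ae_unitV (tr_susp D) Y ∘ fmap Omega g ∘ ae_unit (tr_susp D) X.

Definition unshift k i (g : hom (P (zsucc k)) (P (zsucc i))) :
    hom (P k) (P i) :=
  Sigma_inv (spow_succV i ∘ g ∘ spow_succ k).

Fixpoint shiftn n k i (f : hom (P k) (P i)) :
    hom (P (iter n zsucc k)) (P (iter n zsucc i)) :=
  match n with
  | 0 => f
  | n.+1 => shift (shiftn n f)
  end.

Fixpoint unshiftn n k i :
    hom (P (iter n zsucc k)) (P (iter n zsucc i)) -> hom (P k) (P i) :=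
  match n with
  | 0 => fun g => g
  | n.+1 => fun g => unshiftn (unshift g)
  end.

Definition hcast k k' i i' (ek : k = k') (ei : i = i') (f : hom (P k) (P i)) :
    hom (P k') (P i') :=
  ecast k' (hom (P k') (P i')) ek (ecast i' (hom (P k) (P i')) ei f).

Lemma translate_posE n k k' : Posz n + k = k' -> iter n zsucc k = k'.
Proof. by rewrite iter_zsucc addrC. Qed.

Lemma translate_negE n k k' : Negz n + k = k' -> k = iter n.+1 zsucc k'.
Proof. by rewrite iter_zsucc NegzE => <-; lia. Qed.

(** [translate m] sends [f : Σ^k S -> Σ^i S] to
    [Σ^m f : Σ^(m+k) S -> Σ^(m+i) S]. *)
Definition translate (m : int) k i k' i' :
    m + k = k' -> m + i = i' -> hom (P k) (P i) -> hom (P k') (P i') :=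
  match m with
  | Posz n => fun ek ei f =>
      hcast (translate_posE ek) (translate_posE ei) (shiftn n f)
  | Negz n => fun ek ei f =>
      unshiftn (hcast (translate_negE ek) (translate_negE ei) f)
  end.

(** The product of homogeneous [x : Σ^i S -> S] and [y : Σ^j S -> S] is
    [x ∘ Σ^i y : Σ^(i+j) S -> S]. *)
Definition hmul i j k (e : i + j = k) (x : pi S i S) (y : pi S j S) :
    pi S k S :=
  x ∘ translate (i' := i) e (addr0 i) (y : hom (P j) (P 0)).

Let sig := {p : int * int & hom (P p.1) (P p.2)}.
Let mk k i (f : hom (P k) (P i)) : sig :=
  Tagged (fun p => hom (P p.1) (P p.2)) (i := (k, i)) f.

Lemma mk_inj k i : injective (@mk k i).
Proof. by move=> f g /eqP; rewrite eq_Tagged /= => /eqP. Qed.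

Lemma mk_hcast k k' i i' (ek : k = k') (ei : i = i') (f : hom (P k) (P i)) :
  mk (hcast ek ei f) = mk f.
Proof. by case: _ / ek; case: _ / ei. Qed.

Let up (s : sig) : sig := mk (shift (tagged s)).

Lemma SigmaK X Y : cancel (@fmap D D Sigma X Y) (@Sigma_inv X Y).
Proof.
move=> f; have [uK _] := ae_unitK (tr_susp D) Y.
by rewrite /Sigma_inv -cmpA -ae_unit_nat cmpA uK cmp1l.
Qed.

Lemma Omega_inj X Y : injective (@fmap D D Omega X Y).
Proof.
move=> f g fg; have [_ cK] := ae_counitK (tr_susp D) X.
by rewrite -[f]cmp1r -[g]cmp1r -cK !cmpA !ae_counit_nat -/Omega fg.
Qed.

Lemma Sigma_invK X Y : cancel (@Sigma_inv X Y) (@fmap D D Sigma X Y).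
Proof.
move=> g; apply: Omega_inj; have [_ uY] := ae_unitK (tr_susp D) Y.
have [_ uX] := ae_unitK (tr_susp D) X.
rewrite -[LHS]cmp1r -uX cmpA -ae_unit_nat /Sigma_inv -/Omega !cmpA uY cmp1l.
by rewrite -cmpA uX cmp1r.
Qed.

Lemma shiftK k i : cancel (@shift k i) (@unshift k i).
Proof.
move=> f; have [ki _] := spow_succK i; have [kk _] := spow_succK k.
rewrite /unshift /shift !cmpA ki cmp1l -cmpA kk cmp1r; exact: SigmaK.
Qed.

Lemma unshiftK k i : cancel (@unshift k i) (@shift k i).
Proof.
move=> f; have [_ ki] := spow_succK i; have [_ kk] := spow_succK k.
by rewrite /unshift /shift Sigma_invK !cmpA ki cmp1l -cmpA kk cmp1r.
Qed.

Lemma zsucc_inj : injective zsucc.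
Proof. by move=> i j; rewrite !zsuccE => /addIr. Qed.

Lemma up_inj : injective up.
Proof.
move=> [[k i] f] [[k' i'] f']; rewrite /up /= => e.
have /= ep := congr1 tag e; case: ep => /zsucc_inj ek /zsucc_inj ei.
by case: _ / ek ei f' e => ei; case: _ / ei => f' /mk_inj /(can_inj (@shiftK _ _)) ->.
Qed.

Lemma mk_shiftn n k i (f : hom (P k) (P i)) : mk (shiftn n f) = iter n up (mk f).
Proof. by elim: n => //= n <-. Qed.

Lemma unshiftnK n k i : cancel (@unshiftn n k i) (@shiftn n k i).
Proof. by elim: n => //= n IHn g; rewrite IHn unshiftK. Qed.

(** [translate m f] is determined by any presentation of [m] as a difference. *)
Lemma mk_translate a b m k i k' i' (ek : m + k = k') (ei : m + i = i')
    (f : hom (P k) (P i)) : m = a%:Z - b%:Z ->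
  iter b up (mk (translate ek ei f)) = iter a up (mk f).
Proof.
case: m ek ei => n ek ei /= em.
  by rewrite mk_hcast mk_shiftn -iterD; congr (iter _ _ _); lia.
have -> : (b = a + n.+1)%N by lia.
by rewrite iterD -mk_shiftn unshiftnK mk_hcast.
Qed.

Lemma iter_up_inj n : injective (iter n up).
Proof. by elim: n => //= n IHn s t /up_inj /IHn. Qed.

Lemma int_diff (m : int) : exists a b : nat, m = a%:Z - b%:Z.
Proof.
case: m => n; first by exists n, 0%N; rewrite subr0.
by exists 0%N, n.+1; rewrite NegzE sub0r.
Qed.

Lemma translate0 k i (ek : 0 + k = k) (ei : 0 + i = i) (f : hom (P k) (P i)) :
  translate ek ei f = f.
Proof. by apply: mk_inj; exact: (@mk_translate 0 0). Qed.

Lemma translateD m n k i k' i' k'' i'' (ek : n + k = k') (ei : n + i = i')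
    (ek' : m + k' = k'') (ei' : m + i' = i'')
    (ek'' : (m + n) + k = k'') (ei'' : (m + n) + i = i'') (f : hom (P k) (P i)) :
  translate ek' ei' (translate ek ei f) = translate ek'' ei'' f.
Proof.
have [a [b eab]] := int_diff m; have [c [d ecd]] := int_diff n.
apply: mk_inj; apply: (@iter_up_inj (d + b)).
rewrite [RHS](@mk_translate (a + c)); last by rewrite eab ecd; lia.
rewrite iterD (@mk_translate a) // -iterD addnC iterD (@mk_translate c) //.
by rewrite -iterD.
Qed.

Lemma shift_comp k i j (g : hom (P i) (P j)) (f : hom (P k) (P i)) :
  shift (g ∘ f) = shift g ∘ shift f.
Proof.
have [ki _] := spow_succK i.
by rewrite /shift fmapM !cmpA -[in RHS](cmpA _ _ (spow_succ i)) ki cmp1r.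
Qed.

Lemma shift1 k : shift (idm (P k)) = idm _.
Proof. by have [_ kk] := spow_succK k; rewrite /shift fmap1 cmp1r kk. Qed.

Lemma shiftD k i (f g : hom (P k) (P i)) : shift (f + g) = shift f + shift g.
Proof. by rewrite /shift /Sigma aeFD cmpDr cmpDl. Qed.

Lemma shiftn_comp n k i j (g : hom (P i) (P j)) (f : hom (P k) (P i)) :
  shiftn n (g ∘ f) = shiftn n g ∘ shiftn n f.
Proof. by elim: n => //= n ->; rewrite shift_comp. Qed.

Lemma shiftn1 n k : shiftn n (idm (P k)) = idm _.
Proof. by elim: n => //= n ->; rewrite shift1. Qed.

Lemma shiftnD n k i (f g : hom (P k) (P i)) :
  shiftn n (f + g) = shiftn n f + shiftn n g.
Proof. by elim: n => //= n ->; rewrite shiftD. Qed.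

Lemma shiftnK n k i : cancel (@shiftn n k i) (@unshiftn n k i).
Proof. by elim: n => //= n IHn g; rewrite shiftK IHn. Qed.

Lemma hcast_comp k k' i i' j j' (ek : k = k') (ei : i = i') (ej : j = j')
    (g : hom (P i) (P j)) (f : hom (P k) (P i)) :
  hcast ek ej (g ∘ f) = hcast ei ej g ∘ hcast ek ei f.
Proof. by case: _ / ek; case: _ / ei; case: _ / ej. Qed.

Lemma hcast1 k k' (e : k = k') : hcast e e (idm (P k)) = idm _.
Proof. by case: _ / e. Qed.

Lemma hcastD k k' i i' (ek : k = k') (ei : i = i') (f g : hom (P k) (P i)) :
  hcast ek ei (f + g) = hcast ek ei f + hcast ek ei g.
Proof. by case: _ / ek; case: _ / ei. Qed.

Lemma translate_comp m k i j k' i' j' (ek : m + k = k') (ei : m + i = i')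
    (ej : m + j = j') (g : hom (P i) (P j)) (f : hom (P k) (P i)) :
  translate ek ej (g ∘ f) = translate ei ej g ∘ translate ek ei f.
Proof.
case: m ek ei ej => n ek ei ej; rewrite /translate.
  by rewrite shiftn_comp; exact: hcast_comp.
apply: (can_inj (@shiftnK n.+1 _ _)).
by rewrite shiftn_comp !unshiftnK; exact: hcast_comp.
Qed.

Lemma translate1 m k k' (e e' : m + k = k') : translate e e' (idm _) = idm _.
Proof.
rewrite (eq_irrelevance e' e); case: m e {e'} => n e; rewrite /translate.
  by rewrite shiftn1 hcast1.
by apply: (can_inj (@shiftnK n.+1 _ _)); rewrite unshiftnK shiftn1 hcast1.
Qed.

Lemma translate_add m k i k' i' (ek : m + k = k') (ei : m + i = i')
    (f g : hom (P k) (P i)) :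
  translate ek ei (f + g) = translate ek ei f + translate ek ei g.
Proof.
case: m ek ei => n ek ei; rewrite /translate; first by rewrite shiftnD hcastD.
by apply: (can_inj (@shiftnK n.+1 _ _)); rewrite shiftnD !unshiftnK hcastD.
Qed.

Lemma hmulDl i j k (e : i + j = k) x x' y :
  hmul e (x + x') y = hmul e x y + hmul e x' y.
Proof. exact: cmpDl. Qed.

Lemma hmulDr i j k (e : i + j = k) x y y' :
  hmul e x (y + y') = hmul e x y + hmul e x y'.
Proof. by rewrite /hmul translate_add cmpDr. Qed.

Lemma hmul0l i j k (e : i + j = k) y : hmul e 0 y = 0.
Proof. exact: cmp0l. Qed.

Lemma hmul0r i j k (e : i + j = k) x : hmul e x 0 = 0.
Proof. by apply: (addrI (hmul e x 0)); rewrite -hmulDr !addr0. Qed.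

Lemma hmul_suml i j k (e : i + j = k) (T : Type) (r : seq T) F y :
  hmul e (\sum_(t <- r) F t) y = \sum_(t <- r) hmul e (F t) y.
Proof.
by elim/big_rec2: _ => [|t u v _ <-]; rewrite ?hmul0l ?hmulDl.
Qed.

Lemma hmul_sumr i j k (e : i + j = k) (T : Type) (r : seq T) F x :
  hmul e x (\sum_(t <- r) F t) = \sum_(t <- r) hmul e x (F t).
Proof.
by elim/big_rec2: _ => [|t u v _ <-]; rewrite ?hmul0r ?hmulDr.
Qed.

Lemma hmul1l k (e : 0 + k = k) y : hmul e (idm S : pi S 0 S) y = y.
Proof. by rewrite /hmul translate0; exact: cmp1l. Qed.

Lemma hmul1r k (e : k + 0 = k) x : hmul e x (idm S : pi S 0 S) = x.
Proof. by rewrite /hmul [translate _ _ _]translate1 cmp1r. Qed.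

Lemma hmulA i j l k n m (eij : i + j = k) (ekl : k + l = m)
    (ejl : j + l = n) (ein : i + n = m) x y z :
  hmul ein x (hmul ejl y z) = hmul ekl (hmul eij x y) z.
Proof.
rewrite /hmul (translate_comp _ eij) cmpA; congr (_ ∘ _).
by case: _ / eij ekl => ekl; rewrite (translateD _ _ _ _ ekl (addr0 _)).
Qed.

End Translation.

Section GradedRing.
Variables (D : triangulated) (S : D).

(** [π_* S] as a (total) ring; it is the zero ring when [S] is a zero object,
    hence a [pzRingType]. *)
Definition pi_ring : Type := pi_total S S.
HB.instance Definition _ := GRing.Zmodule.on pi_ring.
Implicit Types x y z : pi_ring.

Definition pi_one_fun (i : int) : pi S i S :=
  match i with
  | Posz 0 => idm S
  | _ => 0
  end.

Lemma pi_one_subproof : finite_set [set i | pi_one_fun i != 0].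
Proof. by apply: (@dsum_finite _ _ _ [:: 0]) => -[[|n]|n]. Qed.

Definition pi_one : pi_ring := Dsum pi_one_subproof.

Lemma pi_mulE (i k : int) : i + (k - i) = k.
Proof. by rewrite addrC subrK. Qed.

Definition pi_mul_fun x y (k : int) : pi S k S :=
  \sum_(i \in [set: int]) hmul (pi_mulE i k) (x i) (y (k - i)).

Lemma fsum_seq (V : zmodType) (s : seq int) (F : int -> V) : uniq s ->
  (forall i, i \notin s -> F i = 0) ->
  \sum_(i \in [set: int]) F i = \sum_(i <- s) F i.
Proof.
move=> us sF; rewrite (fsbigE s) //; last by move=> i _; exact: sF.
by apply: eq_bigl => i; rewrite in_setT.
Qed.

Lemma pi_mul_seq x y s : uniq s -> (forall i, i \notin s -> x i = 0) ->
  forall k, pi_mul_fun x y k =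
    \sum_(i <- s) hmul (pi_mulE i k) (x i) (y (k - i)).
Proof. by move=> us sP k; apply: fsum_seq => // i /sP ->; rewrite hmul0l. Qed.

Lemma pi_mul_supp x y (s t : seq int) : uniq s ->
  (forall i, i \notin s -> x i = 0) -> (forall i, i \notin t -> y i = 0) ->
  forall k, k \notin [seq i + j | i <- s, j <- t] -> pi_mul_fun x y k = 0.
Proof.
move=> us sP tP k nk; rewrite (pi_mul_seq _ us sP).
rewrite big_seq big1 // => i si; rewrite tP ?hmul0r //.
apply: contraNN nk => ti; apply/allpairsP; exists (i, k - i); split => //=.
by rewrite pi_mulE.
Qed.

Lemma pi_mul_subproof x y : finite_set [set k | pi_mul_fun x y k != 0].
Proof.
have [s us sP] := dsum_supp x; have [t _ tP] := dsum_supp y.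
exact: dsum_finite (pi_mul_supp us sP tP).
Qed.

Definition pi_mul x y : pi_ring := Dsum (pi_mul_subproof x y).

Lemma hmul_reindex i j j' l l' k n m (ej : j = j') (el : l = l')
    (eij : i + j = k) (ekl : k + l = m)
    (ejl : j' + l' = n) (ein : i + n = m) x y z :
  hmul ekl (hmul eij (x i) (y j)) (z l) = hmul ein (x i) (hmul ejl (y j') (z l')).
Proof. by case: _ / ej ejl => ejl; case: _ / el ejl => ejl; rewrite (hmulA eij ekl). Qed.

Lemma pi_mulA : associative pi_mul.
Proof.
move=> x y z; apply: dsumP => m /=.
have [s us sP] := dsum_supp x; have [t ut tP] := dsum_supp y.
pose u := undup [seq i + j | i <- s, j <- t].
have uP k : k \notin u -> pi_mul x y k = 0.
  by rewrite mem_undup; exact: pi_mul_supp.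
rewrite (pi_mul_seq _ us sP) (pi_mul_seq _ (undup_uniq _) uP).
under [RHS]eq_bigr => k _.
  rewrite [X in hmul _ X _](pi_mul_seq _ us sP) hmul_suml; over.
rewrite exchange_big /= big_seq [RHS]big_seq; apply: eq_bigr => i si.
rewrite [X in hmul _ _ X](pi_mul_seq _ ut tP) hmul_sumr -fsum_seq //; last first.
  by move=> j /tP ->; rewrite hmul0l hmul0r.
rewrite -[RHS]fsum_seq ?undup_uniq //; last first.
  move=> k; rewrite mem_undup => nk; rewrite tP ?hmul0r ?hmul0l //.
  apply: contraNN nk => ti; apply/allpairsP; exists (i, k - i); split => //=.
  by rewrite pi_mulE.
rewrite [RHS](reindex_fsbigT (fun j => i + j)); last first.
  by exists (fun k => k - i) => j; lia.
by apply: eq_fsbigr => j _; apply/esym/hmul_reindex; lia.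
Qed.

Lemma pi_mulDl : left_distributive pi_mul +%R.
Proof.
move=> x y z; apply: dsumP => k /=.
have [s us sP] := dsum_supp x; have [t ut tP] := dsum_supp y.
pose u := undup (s ++ t); have uu : uniq u := undup_uniq _.
have uxP i : i \notin u -> x i = 0 by rewrite mem_undup mem_cat => /norP[/sP].
have uyP i : i \notin u -> y i = 0 by rewrite mem_undup mem_cat => /norP[_ /tP].
rewrite [X in X = _](@pi_mul_seq _ _ u) //; last first.
  by move=> i iu; rewrite /= uxP // uyP // addr0.
rewrite [X in _ = X + _](@pi_mul_seq _ _ u) // [X in _ = _ + X](@pi_mul_seq _ _ u) //.
by rewrite -big_split; apply: eq_bigr => i _; rewrite hmulDl.
Qed.

Lemma pi_mulDr : right_distributive pi_mul +%R.
Proof.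
move=> x y z; apply: dsumP => k /=.
have [s us sP] := dsum_supp x.
rewrite !(pi_mul_seq _ us sP) -big_split.
by apply: eq_bigr => i _; rewrite hmulDr.
Qed.

Lemma pi_mul1l : left_id pi_one pi_mul.
Proof.
move=> x; apply: dsumP => k /=.
rewrite (@pi_mul_seq _ _ [:: 0]) //; last by move=> -[[|n]|n].
rewrite big_seq1; move: (pi_mulE 0 k); rewrite subr0 => e.
exact: hmul1l.
Qed.

Lemma pi_mul1r : right_id pi_one pi_mul.
Proof.
move=> x; apply: dsumP => k /=; rewrite /pi_mul_fun (@fsum_seq _ [:: k]) //.
  by rewrite big_seq1; move: (pi_mulE k k); rewrite subrr => e; exact: hmul1r.
move=> i; rewrite inE => ik.
have : k - i != 0 by rewrite subr_eq0 eq_sym.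
by case: (k - i) (pi_mulE i k) => [[|n]|n] e // _; exact: hmul0r.
Qed.

HB.instance Definition _ := GRing.Zmodule_isPzRing.Build pi_ring
  pi_mulA pi_mul1l pi_mul1r pi_mulDl pi_mulDr.

End GradedRing.

Definition concentrated_in_degree_zero (D : triangulated) (S : D) : Prop :=
  forall i : int, i != 0 -> forall x : pi S i S, x = 0.

Definition von_neumann_regular (R : pzRingType) : Prop :=
  forall x : R, exists y : R, x * y * x = x.

(* Main.v *)
From mathcomp Require Import all_boot all_order all_algebra.
From mathcomp Require Import zify boolp classical_sets cardinality.
Require Import Defs.

Set Implicit Arguments.
Unset Strict Implicit.
Unset Printing Implicit Defensive.

Import GRing.Theory.
Local Open Scope ring_scope.
Local Open Scope cat_scope.

(** The only morphisms that matter are the von Neumann regular ones, those [f]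
    with [f ∘ g ∘ f = f] for some [g].  Since [π_* S] is concentrated in degree
    zero it is [End S], and it is von Neumann regular exactly when every
    endomorphism of [S] is a regular morphism.

    Suppose that this is so, and call an object built if it is obtained from
    the [Σ^i S] by finite biproducts and retracts.  Maps between the [Σ^i S] are
    regular, because [End (Σ^i S) = End S] and there are no nonzero maps
    from [Σ^i S] to [Σ^j S] for [i] different from [j].  Regularity of all maps
    passes to biproducts and retracts in either variable
    ([regular_biproduct_dom], the Gaussian elimination step that shows matrix
    rings over a regular ring to be regular).  If [f : X -> Y] is regular then
    its cone is a retract of [Y ⊕ ΣX] ([regular_cone]).  Hence the built objects
    form a thick subcategory, which contains that of [S].  A map out of a built
    object is zero as soon as it vanishes on homotopy, because this holds for
    maps out of [Σ^i S], and the generating hypothesis follows.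

    Conversely, assume the generating hypothesis and let [x : S -> S] have cone
    [S -g-> Z -h-> ΣS].  Homotopy of [Z] in degree one is the annihilator
    of [x].  So if [u : ΣS -> Y], with [Y] in the thick subcategory, kills the
    annihilator of [x], then [u ∘ h] vanishes on homotopy, so [u ∘ h = 0] and
    [u] factors through [Σx] ([gh_extend_Sigma]).  This is used twice.  With
    [Y = ΣS] it says that an [a] killing the annihilator of [x] is a multiple
    of [x] ([double_annihilator]).  With [Y = Z], and [u] the lift through [h]
    of an element [w] of [(x)] with [x ∘ w = 0], it gives [w = 0], so that [x]
    and [x ∘ x] have the same annihilator ([annihilator_sqr]).  Then [x] kills
    the annihilator of [x ∘ x], so it is a multiple of [x ∘ x]; as [End S] is
    commutative, this is regularity of [x]. *)

(** * Direct sums *)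

Lemma dsum_single_subproof (I : choiceType) (G : I -> zmodType) i (x : G i) :
  finite_set [set j | dfwith (fun j => 0 : G j) x j != 0]%classic.
Proof.
apply: (@dsum_finite _ _ _ [:: i]) => j; rewrite inE => ji.
by rewrite dfwith_out // eq_sym.
Qed.

Definition dsum_single (I : choiceType) (G : I -> zmodType) i (x : G i) :
  dsum G := Dsum (dsum_single_subproof x).

Lemma dsum_singleE (I : choiceType) (G : I -> zmodType) i (x : G i) :
  dsum_single x i = x.
Proof. exact: dfwith_in. Qed.

(** * Regular morphisms in a preadditive category *)

Section Preadditive.
Variable C : preadditive.
Implicit Types X Y Z : C.

Lemma cmpNl X Y Z (g : hom Y Z) (f : hom X Y) : (- g) ∘ f = - (g ∘ f).
Proof. by apply: (addrI (g ∘ f)); rewrite -cmpDl !subrr cmp0l. Qed.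

Lemma cmpNr X Y Z (g : hom Y Z) (f : hom X Y) : g ∘ (- f) = - (g ∘ f).
Proof. by apply: (addrI (g ∘ f)); rewrite -cmpDr !subrr cmp0r. Qed.

Lemma cmpBl X Y Z (g g' : hom Y Z) (f : hom X Y) :
  (g - g') ∘ f = g ∘ f - g' ∘ f.
Proof. by rewrite cmpDl cmpNl. Qed.

Lemma cmpBr X Y Z (g : hom Y Z) (f f' : hom X Y) :
  g ∘ (f - f') = g ∘ f - g ∘ f'.
Proof. by rewrite cmpDr cmpNr. Qed.

Lemma inverses_retract X Y (f : hom X Y) (g : hom Y X) :
  inverses f g -> is_retract X Y.
Proof. by case=> gf _; exists f, g. Qed.

Lemma inverses_sym X Y (f : hom X Y) (g : hom Y X) :
  inverses f g -> inverses g f.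
Proof. by case. Qed.

Definition regular X Y (f : hom X Y) : Prop :=
  exists g : hom Y X, f ∘ g ∘ f = f.

(** A map between retracts extends to the ambient objects, and the two
    idempotents disappear when an inner inverse is restricted back. *)
Lemma regular_retract X Y X' Y' :
  is_retract X X' -> is_retract Y Y' ->
  (forall f : hom X' Y', regular f) -> forall f : hom X Y, regular f.
Proof.
move=> [i [r ri]] [j [q qj]] reg f.
have [u uP] := reg (j ∘ f ∘ r); exists (r ∘ u ∘ j).
have := congr1 (fun t => q ∘ t ∘ i) uP.
by rewrite -!cmpA ri cmp1r !cmpA qj cmp1l.
Qed.

(** Gaussian elimination.  Write [f] as a row [(a, b)].  If [a'] is an inner
    inverse of [a], the idempotent [e = 1 - a ∘ a'] kills [a], and the column
    operation replacing [b] by [e ∘ b] leaves a row whose entries can be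
    inverted separately. *)
Lemma regular_biproduct_dom X X' P Y (i1 : hom X P) (i2 : hom X' P)
    (p1 : hom P X) (p2 : hom P X') :
  is_biproduct i1 i2 p1 p2 ->
  (forall f : hom X Y, regular f) -> (forall f : hom X' Y, regular f) ->
  forall f : hom P Y, regular f.
Proof.
move=> [_ _ _ _ e1] reg reg' f.
pose a := f ∘ i1; pose b := f ∘ i2.
have [a' aK] : regular a by exact: reg.
pose e := idm Y - a ∘ a'.
have ea : e ∘ a = 0 by rewrite /e cmpBl cmp1l aK subrr.
have [c cK] : regular (e ∘ b) by exact: reg'.
(* The column [(a', c ∘ e)] inverts the reduced row [(a, e ∘ b)]; the last term
   undoes the column operation that reduced [(a, b)]. *)
exists (i1 ∘ a' + i2 ∘ c ∘ e - i1 ∘ a' ∘ b ∘ c ∘ e).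
have -> : f ∘ (i1 ∘ a' + i2 ∘ c ∘ e - i1 ∘ a' ∘ b ∘ c ∘ e)
   = a ∘ a' + e ∘ b ∘ c ∘ e.
  rewrite cmpBr cmpDr !cmpA -/a -/b -addrA; congr (_ + _).
  by rewrite /e !cmpBl cmp1l.
set v := _ + _.
have va : v ∘ a = a by rewrite cmpDl aK -[_ ∘ e ∘ a]cmpA ea cmp0r addr0.
have vb : v ∘ b = b.
  rewrite cmpDl -[_ ∘ e ∘ b]cmpA cK /e cmpBl cmp1l.
  by rewrite addrC subrK.
have fE : f = a ∘ p1 + b ∘ p2 by rewrite -[LHS]cmp1r -e1 cmpDr !cmpA.
by rewrite {1}fE cmpDr (cmpA _ a) (cmpA _ b) va vb -fE.
Qed.

Definition opposite : preadditive.
Proof.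
refine (@Preadditive (obj C) (fun X Y => hom Y X) (fun X => idm X)
  (fun X Y Z g f => f ∘ g) _ _ _ _ _); first by move=> *; rewrite cmpA.
- by move=> *; rewrite cmp1r.
- by move=> *; rewrite cmp1l.
- by move=> *; rewrite cmpDr.
- by move=> *; rewrite cmpDl.
Defined.

End Preadditive.

(** Regularity and biproducts are self-dual notions, so the previous lemma in
    the opposite category applies. *)
Lemma regular_biproduct_cod (C : preadditive) (X Y Y' P : C)
    (i1 : hom Y P) (i2 : hom Y' P) (p1 : hom P Y) (p2 : hom P Y') :
  is_biproduct i1 i2 p1 p2 ->
  (forall f : hom X Y, regular f) -> (forall f : hom X Y', regular f) ->
  forall f : hom X P, regular f.
Proof.
have op (A B : C) (f : hom A B) : @regular (opposite C) B A f <-> regular f.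
  by split=> -[g]; rewrite /= ?cmpA => gP; exists g; rewrite /= ?cmpA.
move=> [e1 e2 e12 e21 e] reg reg' f; apply/op.
apply: (@regular_biproduct_dom (opposite C) Y Y' P X p1 p2 i1 i2); last 2 first.
- by move=> u; apply/op.
- by move=> u; apply/op.
by split.
Qed.

(** * Suspension and exact triangles *)

Section Triangulated.
Variable D : triangulated.
Implicit Types X Y Z W : D.
Local Notation Σ := (@Sigma D).
Local Notation Ω := (@Omega D).

Lemma Sigma_inj X Y : injective (@fmap D D Sigma X Y).
Proof. exact: can_inj (@SigmaK D X Y). Qed.

Lemma SigmaD X Y (f g : hom X Y) : fmap Σ (f + g) = fmap Σ f + fmap Σ g.
Proof. exact: aeFD. Qed.

Lemma Sigma0 X Y : fmap Σ (0 : hom X Y) = 0.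
Proof. by apply: (addrI (fmap Σ 0)); rewrite -SigmaD !addr0. Qed.

(** Additivity is part of the data for [Σ] only; [Ω] inherits it because [ΣΩ] is
    naturally isomorphic to the identity and [Σ] is faithful. *)
Lemma OmegaD X Y (f g : hom X Y) : fmap Ω (f + g) = fmap Ω f + fmap Ω g.
Proof.
have [cV _] := ae_counitK (tr_susp D) Y.
have E (u : hom X Y) :
    fmap Σ (fmap Ω u) = ae_counitV _ Y ∘ u ∘ ae_counit (tr_susp D) X.
  by rewrite -cmpA ae_counit_nat cmpA cV cmp1l.
by apply: Sigma_inj; rewrite SigmaD !E cmpDr cmpDl.
Qed.

Lemma functor_retract (F : functor D D) X Y :
  is_retract X Y -> is_retract (F X) (F Y).
Proof.
by move=> [i [r ri]]; exists (fmap F i), (fmap F r); rewrite -fmapM ri fmap1.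
Qed.

Lemma functor_biproduct (F : functor D D) :
  (forall (X Y : D) (f g : hom X Y), fmap F (f + g) = fmap F f + fmap F g) ->
  forall (X Y P : D) (i1 : hom X P) (i2 : hom Y P) (p1 : hom P X) (p2 : hom P Y),
  is_biproduct i1 i2 p1 p2 ->
  is_biproduct (fmap F i1) (fmap F i2) (fmap F p1) (fmap F p2).
Proof.
move=> FD X Y P i1 i2 p1 p2 [e1 e2 e12 e21 e].
have F0 (A B : D) : fmap F (0 : hom A B) = 0.
  by apply: (addrI (fmap F 0)); rewrite -FD !addr0.
by split; rewrite -!fmapM ?e1 ?e2 ?e12 ?e21 ?F0 ?fmap1 // -FD e fmap1.
Qed.

Lemma retract_Omega_Sigma X : is_retract X (Ω (Σ X)).
Proof. exact: inverses_retract (ae_unitK (tr_susp D) X). Qed.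

Lemma Omega_Sigma_retract X : is_retract (Ω (Σ X)) X.
Proof. exact: inverses_retract (inverses_sym (ae_unitK (tr_susp D) X)). Qed.

Section Triangle.
Variables (X Y Z : D) (f : hom X Y) (g : hom Y Z) (h : hom Z (Σ X)).
Hypothesis fgh : dist f g h.

(** The map to compare with is the identity triangle on [X]. *)
Lemma dist_cmp0 : g ∘ f = 0.
Proof.
have [[O O0] _] := tr_additive D.
have [|c [<- _]] := dist_map (a := idm X) (b := f) (dist_id X O0) fgh.
  by [].
by rewrite cmp0r.
Qed.

(** The map [u] is completed to a morphism into the triangle [0 -> W = W]. *)
Lemma dist_weak_cokernel W (u : hom Y W) : u ∘ f = 0 -> exists v, v ∘ g = u.
Proof.
move=> uf; have [[O O0] _] := tr_additive D.
have SO0 : is_zero (Σ O) by rewrite /is_zero -fmap1 O0 Sigma0.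
have tri : dist (0 : hom O W) (idm W) (0 : hom W (Σ O)).
  apply/dist_rot; rewrite [fmap _ _]Sigma0 oppr0.
  exact: dist_id.
have [|c [cg _]] := dist_map (a := (0 : hom X O)) (b := u) fgh tri.
  by rewrite uf cmp0r.
by exists c; rewrite cg cmp1l.
Qed.

(** Completing [u] to a morphism from the triangle [W -> 0 -> ΣW] gives [Σv], and
    [Σ] is full. *)
Lemma dist_weak_kernel W (u : hom W Y) : g ∘ u = 0 -> exists v, f ∘ v = u.
Proof.
move=> gu; have [[O O0] _] := tr_additive D.
have /dist_rot tri := dist_id W O0; have /dist_rot fgh' := fgh.
have [|c [_]] := dist_map (a := u) (b := (0 : hom O Z)) tri fgh'.
  by rewrite gu cmp0r.
rewrite cmpNr cmpNl => /oppr_inj e; exists (Sigma_inv c).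
by apply: Sigma_inj; rewrite fmapM Sigma_invK -[LHS]e fmap1 cmp1r.
Qed.

End Triangle.

(** Idempotents need not split, so the cone is compared with [Y ⊕ ΣX] directly.
    The idempotent [1 - f ∘ f'] kills [f], so it is [s ∘ g]; then [g ∘ s ∘ g = g],
    so [1 - g ∘ s] kills [g] and is [t ∘ h].  Thus [1 = g ∘ s + t ∘ h]. *)
Lemma regular_cone X Y Z P (f : hom X Y) (g : hom Y Z) (h : hom Z (Σ X))
    (i1 : hom Y P) (i2 : hom (Σ X) P) (p1 : hom P Y) (p2 : hom P (Σ X)) :
  dist f g h -> regular f -> is_biproduct i1 i2 p1 p2 -> is_retract Z P.
Proof.
move=> fgh [f' fK] [e1 e2 e12 e21 _].
have [|s sg] := @dist_weak_cokernel _ _ _ _ _ _ fgh _ (idm Y - f ∘ f').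
  by rewrite cmpBl cmp1l fK subrr.
have /dist_rot ghf := fgh.
have [|t th] := @dist_weak_cokernel _ _ _ _ _ _ ghf _ (idm Z - g ∘ s).
  rewrite cmpBl cmp1l -cmpA sg cmpBr cmp1r cmpA (dist_cmp0 fgh) cmp0l subr0.
  exact: subrr.
exists (i1 ∘ s + i2 ∘ h), (g ∘ p1 + t ∘ p2).
rewrite cmpDl !cmpDr !cmpA -![_ ∘ p1 ∘ _]cmpA -![_ ∘ p2 ∘ _]cmpA.
by rewrite e1 e2 e12 e21 !cmp1r !cmp0r !cmp0l addr0 add0r th addrC subrK.
Qed.

(** * Maps between suspensions of [S] *)

Section Spheres.
Variable S : D.
Local Notation P i := (spow i S).

Lemma translate_inj m k i k' i' (ek : m + k = k') (ei : m + i = i') :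
  injective (translate (S := S) ek ei).
Proof.
have ek' : - m + k' = k by rewrite -ek addKr.
have ei' : - m + i' = i by rewrite -ei addKr.
apply: (can_inj (g := translate ek' ei')) => f.
have e0 : - m + m = 0 by exact: addNr.
have ek0 : - m + m + k = k by rewrite e0 add0r.
have ei0 : - m + m + i = i by rewrite e0 add0r.
rewrite (translateD _ _ _ _ ek0 ei0); move: ek0 ei0; rewrite e0 => *.
exact: translate0.
Qed.

(** Translation by [- j] embeds these maps in [π_(i - j) S]. *)
Lemma hom_spow_eq0 i j (f : hom (P i) (P j)) :
  concentrated_in_degree_zero S -> i <> j -> f = 0.
Proof.
move=> deg0 ij.
apply: (@translate_inj (- j) _ _ (- j + i) 0 erefl (addNr j)).
rewrite [LHS]deg0; last by apply/eqP => ?; apply: ij; lia.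
by rewrite [RHS]deg0 //; apply/eqP => ?; apply: ij; lia.
Qed.

(** Translation by [- i] is an isomorphism of [End (Σ^i S)] with [End S]. *)
Lemma regular_spow i :
  (forall f : hom S S, regular f) -> forall f : hom (P i) (P i), regular f.
Proof.
move=> reg f; have e : - i + i = 0 by exact: addNr.
have [g gP] := reg (translate (k' := 0) (i' := 0) e e f).
have e' : i + 0 = i by exact: addr0.
exists (translate (k := 0) (i := 0) e' e' g).
apply: (@translate_inj (- i) _ _ 0 0 e e).
rewrite !(translate_comp _ e) -{}[RHS]gP.
have e0 : - i + i + 0 = 0 by rewrite e.
rewrite (translateD _ _ _ _ e0 e0).
have -> : translate e0 e0 g = g by move: (e0); rewrite e => e1; exact: translate0.
by [].
Qed.

(** * Objects built from suspensions of [S] *)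

Inductive built : D -> Prop :=
| built_spow i : built (P i)
| built_biproduct X Y Q (i1 : hom X Q) (i2 : hom Y Q)
    (p1 : hom Q X) (p2 : hom Q Y) :
    is_biproduct i1 i2 p1 p2 -> built X -> built Y -> built Q
| built_retract X Y : is_retract X Y -> built Y -> built X.

Lemma built_functor (F : functor D D) :
  (forall (X Y : D) (f g : hom X Y), fmap F (f + g) = fmap F f + fmap F g) ->
  (forall i, built (F (P i))) -> forall X, built X -> built (F X).
Proof.
move=> FD FP X; elim=> [//|A B Q i1 i2 p1 p2 bip _ bA _ bB|A B AB _ bB].
- exact: built_biproduct (functor_biproduct FD bip) bA bB.
- exact: built_retract (functor_retract F AB) bB.
Qed.

Lemma built_Sigma X : built X -> built (Σ X).
Proof.
apply: built_functor; first exact: SigmaD.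
move=> i; apply: built_retract (built_spow (zsucc i)).
exact: inverses_retract (spow_succK S i).
Qed.

Lemma built_Omega X : built X -> built (Ω X).
Proof.
apply: built_functor; first exact: OmegaD.
case=> [[|n]|n]; [exact: (built_spow (Negz 0)) | | exact: (built_spow (Negz n.+1))].
exact: built_retract (Omega_Sigma_retract _) (built_spow (Posz n)).
Qed.

Lemma built_regular X Y :
  concentrated_in_degree_zero S -> (forall f : hom S S, regular f) ->
  built X -> built Y -> forall f : hom X Y, regular f.
Proof.
move=> deg0 reg bX bY.
elim: bX => [i|A B Q i1 i2 p1 p2 bip _ rA _ rB|A B AB _ rB]; last 2 first.
- exact: regular_biproduct_dom bip rA rB.
- apply: regular_retract AB _ rB; exists (idm Y), (idm Y); exact: cmp1l.
elim: bY => [j|A B Q i1 i2 p1 p2 bip _ rA _ rB|A B AB _ rB]; last 2 first.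
- exact: regular_biproduct_cod bip rA rB.
- apply: regular_retract _ AB rB; exists (idm _), (idm _); exact: cmp1l.
have [<- f|ij f] := eqVneq i j; first exact: regular_spow.
exists 0; rewrite cmp0r cmp0l; apply/esym/hom_spow_eq0 => //; exact/eqP.
Qed.

Lemma built_cone X Y Z (f : hom X Y) (g : hom Y Z) (h : hom Z (Σ X)) :
  concentrated_in_degree_zero S -> (forall f : hom S S, regular f) ->
  dist f g h -> built X -> built Y -> built Z.
Proof.
move=> deg0 reg fgh bX bY; have bSX := built_Sigma bX.
have [_ /(_ Y (Σ X))[Q [i1 [i2 [p1 [p2 bip]]]]]] := tr_additive D.
apply: built_retract (built_biproduct bip bY bSX).
exact: regular_cone fgh (built_regular deg0 reg bX bY f) bip.
Qed.

(** In a triangle the first object desuspends the cone of the second map, and the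
    second object desuspends the cone of the third, so [built_cone] gives all of
    two-out-of-three. *)
Lemma built_thick :
  concentrated_in_degree_zero S -> (forall f : hom S S, regular f) ->
  is_thick built.
Proof.
move=> deg0 reg; split.
- exact: built_Sigma.
- exact: built_Omega.
- exact: built_retract.
move=> X Y Z f g h fgh; have cone := built_cone deg0 reg.
have desusp A : built (Σ A) -> built A.
  by move=> bSA; exact: built_retract (retract_Omega_Sigma A) (built_Omega bSA).
have /dist_rot ghf := fgh; have /dist_rot hfg := ghf.
split=> b1 b2; first exact: cone fgh b1 b2.
- by apply: desusp; apply: cone hfg b2 (built_Sigma b1).
- by apply: desusp; apply: cone ghf b1 b2.
Qed.

Lemma built_eq0 X : built X -> forall Y (f : hom X Y),
  (forall i (x : hom (P i) X), f ∘ x = 0) -> f = 0.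
Proof.
elim=> [i|A B Q i1 i2 p1 p2 [_ _ _ _ e] _ fA _ fB|A B [i [r ri]] _ fB] Y f f0.
- by rewrite -[f]cmp1r f0.
- have f1 : f ∘ i1 = 0 by apply: fA => i x; rewrite -cmpA f0.
  have f2 : f ∘ i2 = 0 by apply: fB => i x; rewrite -cmpA f0.
  by rewrite -[f]cmp1r -e cmpDr !cmpA f1 f2 !cmp0l addr0.
- have fr : f ∘ r = 0 by apply: fB => j x; rewrite -cmpA f0.
  by rewrite -[f]cmp1r -ri cmpA fr cmp0l.
Qed.

(** * The generating hypothesis and the ring [End S] *)

Lemma pi_map_eq0 X Y (f : hom X Y) :
  (forall x : pi_total S X, pi_map f x = 0) <->
  (forall i (x : hom (P i) X), f ∘ x = 0).
Proof.
split=> [f0 i x|f0 x]; last by apply: dsumP => i; exact: f0.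
have := congr1 (fun t : pi_total S Y => t i)
  (f0 (dsum_single (G := fun j => pi S j X) x)).
by rewrite /= [dfwith _ _ _]dfwith_in.
Qed.

Lemma pi_mul_deg0 (x y : pi_ring S) : concentrated_in_degree_zero S ->
  (x * y) 0 = (x 0 : hom S S) ∘ y 0.
Proof.
move=> deg0.
rewrite [LHS](@pi_mul_seq _ _ _ _ [:: 0]) //; last first.
  by move=> i; rewrite inE; move/deg0; apply.
rewrite big_seq1; congr (_ ∘ _); exact: translate0.
Qed.

Lemma pi_ring_eq (x y : pi_ring S) : concentrated_in_degree_zero S ->
  x 0 = y 0 -> x = y.
Proof.
move=> deg0 xy; apply: dsumP => i; have [->//|i0] := eqVneq i 0.
by rewrite (deg0 i i0 (x i)) (deg0 i i0 (y i)).
Qed.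

Definition deg0_elt (f : hom S S) : pi_ring S :=
  dsum_single (G := fun j => pi S j S) (i := 0) f.

Lemma deg0_eltE f : deg0_elt f 0 = f.
Proof. exact: dsum_singleE. Qed.

Lemma von_neumann_regularE : concentrated_in_degree_zero S ->
  von_neumann_regular (pi_ring S) <-> (forall f : hom S S, regular f).
Proof.
move=> deg0; split=> [reg f|reg x].
  have [y yP] := reg (deg0_elt f); exists (y 0).
  have := congr1 (fun t : pi_ring S => t 0) yP.
  by rewrite !pi_mul_deg0 // deg0_eltE.
have [y yP] := reg (x 0); exists (deg0_elt y).
by apply: pi_ring_eq => //; rewrite !pi_mul_deg0 // deg0_eltE.
Qed.

Lemma generating_hypothesis_of_regular : concentrated_in_degree_zero S ->
  (forall f : hom S S, regular f) -> generating_hypothesis S.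
Proof.
move=> deg0 reg X Y f thX _ /pi_map_eq0; apply: built_eq0.
exact: thX (built_thick deg0 reg) (built_spow 0).
Qed.

(** * Consequences of the generating hypothesis *)

Section Converse.
Hypothesis deg0 : concentrated_in_degree_zero S.
Hypothesis comm : forall f g : hom S S, f ∘ g = g ∘ f.
Hypothesis gh : generating_hypothesis S.

Lemma thick_Sigma_S : in_thick S (Σ S).
Proof. by move=> Q thQ QS; apply: thick_susp. Qed.

Lemma thick_cone (x : hom S S) Z (g : hom S Z) (h : hom Z (Σ S)) :
  dist x g h -> in_thick S Z.
Proof. by move=> xgh Q thQ QS; have [/(_ QS QS)] := thick_cofiber thQ xgh. Qed.

(** A class in [π_i Z] composes with [h] to a map [Σ^i S -> ΣS], which is zero
    unless [i = 1], and is then the suspension of some [v] with [x ∘ v = 0].  So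
    the hypothesis on [u] makes [u ∘ h] vanish on homotopy, and [Σx] is a weak
    cokernel of [h] up to sign. *)
Lemma gh_extend_Sigma (x : hom S S) Z (g : hom S Z) (h : hom Z (Σ S)) Y
    (u : hom (Σ S) Y) : dist x g h -> in_thick S Y ->
  (forall v : hom S S, x ∘ v = 0 -> u ∘ fmap Σ v = 0) ->
  exists k : hom (Σ S) Y, k ∘ fmap Σ x = u.
Proof.
move=> xgh thY uP; have /dist_rot ghx := xgh; have /dist_rot hxg := ghx.
have uh : u ∘ h = 0.
  apply: gh (thick_cone xgh) thY _; apply/pi_map_eq0 => i y; rewrite -cmpA.
  have [->|i1] := eqVneq (h ∘ y) 0; first by rewrite cmp0r.
  have ei : i = 1.
    apply: contra_neq_eq i1 => /eqP; exact: (@hom_spow_eq0 i 1).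
  rewrite {}ei in y {i1} *.
  have := uP (Sigma_inv (h ∘ y)); rewrite Sigma_invK; apply.
  apply: Sigma_inj; rewrite fmapM Sigma_invK cmpA Sigma0.
  by apply: oppr_inj; rewrite -!cmpNl (dist_cmp0 hxg) cmp0l oppr0.
have [k kP] := dist_weak_cokernel hxg uh.
by exists (- k); rewrite cmpNl -cmpNr.
Qed.

Lemma double_annihilator (x a : hom S S) :
  (forall v : hom S S, x ∘ v = 0 -> a ∘ v = 0) -> exists b, b ∘ x = a.
Proof.
move=> xa; have [Z [g [h xgh]]] := dist_cone x.
have [v xv|k kP] := gh_extend_Sigma (u := fmap Σ a) xgh thick_Sigma_S.
  by rewrite -fmapM xa // Sigma0.
by exists (Sigma_inv k); apply: Sigma_inj; rewrite fmapM Sigma_invK.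
Qed.

(** The element [x ∘ v] is killed by [x], so its suspension lifts through [h] to
    some [w : ΣS -> Z].  For [x ∘ t = 0], commutativity gives [x ∘ v ∘ t = 0], so
    [w ∘ Σt] lifts through [g] to [π_1 S = 0].  Hence [w = k ∘ Σx] and
    [Σ(x ∘ v) = (h ∘ k) ∘ Σx], which equals [Σx ∘ (h ∘ k) = 0]. *)
Lemma annihilator_sqr (x v : hom S S) : x ∘ x ∘ v = 0 -> x ∘ v = 0.
Proof.
move=> xxv; have [Z [g [h xgh]]] := dist_cone x.
have /dist_rot ghx := xgh; have /dist_rot hxg := ghx.
have [|w hw] := dist_weak_kernel hxg (u := fmap Σ (x ∘ v)).
  by rewrite cmpNl -fmapM cmpA xxv Sigma0 oppr0.
have [t xt|k kP] := gh_extend_Sigma (u := w) xgh (thick_cone xgh).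
  have [|m <-] := dist_weak_kernel ghx (u := w ∘ fmap Σ t).
    by rewrite cmpA hw -fmapM -cmpA (comm v) cmpA xt cmp0l Sigma0.
  by rewrite (@hom_spow_eq0 1 0 m) ?cmp0r.
have hk0 : x ∘ Sigma_inv (h ∘ k) = 0.
  apply: Sigma_inj; rewrite fmapM Sigma_invK cmpA Sigma0.
  by apply: oppr_inj; rewrite -!cmpNl (dist_cmp0 hxg) cmp0l oppr0.
by apply: Sigma_inj; rewrite -hw -kP cmpA -[h ∘ k]Sigma_invK -fmapM comm hk0.
Qed.

Lemma regular_of_generating_hypothesis (x : hom S S) : regular x.
Proof.
have [v xxv|b bP] := @double_annihilator (x ∘ x) x; first exact: annihilator_sqr.
by exists b; rewrite -cmpA comm -cmpA.
Qed.
End Converse.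
End Spheres.
End Triangulated.

Theorem theoremA (D : triangulated) (S : D)
    (D_coprod : has_coproducts D)
    (R_comm : forall x y : pi_ring S, x * y = y * x)
    (R_deg0 : concentrated_in_degree_zero S) :
  generating_hypothesis S <-> von_neumann_regular (pi_ring S).
Proof.
rewrite von_neumann_regularE //; split=> [gh f|].
  apply: regular_of_generating_hypothesis => // a b.
  have := congr1 (fun t : pi_ring S => t 0) (R_comm (deg0_elt a) (deg0_elt b)).
  by rewrite !pi_mul_deg0 // !deg0_eltE.
exact: generating_hypothesis_of_regular.
Qed.
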